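(* Let $f:\mathbb{R}^n\to(-\infty,+\infty]$ be a proper convex function whose set of minimizers is nonempty and such that $f(\mathbf{x})=+\infty$ for all $\mathbf{x}$ in the boundary of $\mathrm{dom}\,f$ (so $\mathrm{dom}\,f$ is open). Let $\psi:\mathbb{R}^n\to\mathbb{R}$ be a finite-valued convex function and let $\lambda:[0,\infty)\to(0,\infty)$ be a positive-valued function. Suppose that $\boldsymbol{\rho}:[0,1]\to\mathrm{dom}\,f$ is a searching path (i.e. a continuous map) via regularization with penalty $\psi$ and tuner $\lambda$, i.e. for every $t\in[0,1]$ the point $\boldsymbol{\rho}(t)$ is a minimizer over $\mathbf{x}\in\mathbb{R}^n$ of $f(\mathbf{x})+\lambda(t)\psi(\mathbf{x})$. Then the following hold. (i) If $t_1,t_2\in[0,1]$ and $f(\boldsymbol{\rho}(t_1))=f(\boldsymbol{\rho}(t_2))$, then $\psi(\boldsymbol{\rho}(t_1))=\psi(\boldsymbol{\rho}(t_2))$. Moreover, there is a hyperplane $H$ such that for each $t\in[0,1]$ satisfying $f(\boldsymbol{\rho}(t))=f(\boldsymbol{\rho}(t_1))$ there is a subgradient $f'(\boldsymbol{\rho}(t))\in\partial f(\boldsymbol{\rho}(t))$ such that $H(\boldsymbol{\rho}(t),f'(\boldsymbol{\rho}(t)))=H$. (ii) If $t_1,t_2\in[0,1]$ and $f(\boldsymbol{\rho}(t_1))>f(\boldsymbol{\rho}(t_2))$, then $\psi(\boldsymbol{\rho}(t_1))<\psi(\boldsymbol{\rho}(t_2))$ and $\boldsymbol{\rho}(t_1)\in\mathrm{int}\,U^{+}_{f}(\boldsymbol{\rho}(t_2))$.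 (iii) $\mathrm{int}\,V^{+}_{f}(\boldsymbol{\rho})\neq\emptyset$.
   Context: $\mathrm{dom}\,f=\{\mathbf{x}\in\mathbb{R}^n : f(\mathbf{x})<+\infty\}$ and $\partial f(\mathbf{x})$ is the convex subdifferential. For $\mathbf{x}\in\mathrm{dom}\,f$ and $\mathbf{x}^{*}\in\partial f(\mathbf{x})$ set $$H^{+}(\mathbf{x},\mathbf{x}^{*})=\{\mathbf{y}:\langle\mathbf{x}^{*},\mathbf{y}-\mathbf{x}\rangle\ge 0\},\qquad H(\mathbf{x},\mathbf{x}^{*})=\{\mathbf{y}:\langle\mathbf{x}^{*},\mathbf{y}-\mathbf{x}\rangle=0\}.$$ In the degenerate case $\mathbf{x}^{*}=\mathbf{0}$ both sets equal $\mathbb{R}^n$; by convention $H(\mathbf{x},\mathbf{x}^{*})$ is still called a hyperplane and $H^{+}(\mathbf{x},\mathbf{x}^{*})$ a halfspace in this case. The upper region of $f$ at $\mathbf{x}\in\mathrm{dom}\,f$ is $U^{+}_{f}(\mathbf{x})=\bigcup_{\mathbf{x}^{*}\in\partial f(\mathbf{x})}H^{+}(\mathbf{x},\mathbf{x}^{*})$. The ultimate region of $f$ with respect to a path $\boldsymbol{\rho}:[0,1]\to\mathrm{dom}\,f$ is $V^{+}_{f}(\boldsymbol{\rho})=\bigcap_{t\in[0,1]}U^{+}_{f}(\boldsymbol{\rho}(t))$. $\mathrm{int}$ denotes the topological interior in $\mathbb{R}^n$. *)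

(* Defs.v *)
From mathcomp Require Import all_boot all_order all_algebra.
From mathcomp Require Import all_classical all_reals all_analysis.

Set Implicit Arguments.
Unset Strict Implicit.
Unset Printing Implicit Defensive.

Import Order.TTheory GRing.Theory Num.Theory.
Import numFieldNormedType.Exports.

Local Open Scope classical_set_scope.
Local Open Scope ring_scope.

Definition inner (R : realType) (n : nat) (u v : 'rV[R]_n) : R :=
  \sum_(i < n) u 0 i * v 0 i.

Definition boundary (T : topologicalType) (A : set T) : set T :=
  closure A `\` A°.

Definition edom (R : realType) (n : nat) (f : 'rV[R]_n -> \bar R) :
  set 'rV[R]_n := [set x | (f x < +oo)%E].

Definition proper_fun (R : realType) (n : nat) (f : 'rV[R]_n -> \bar R) :
  Prop := (forall x, f x != -oo%E) /\ edom f !=set0.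

(* Only meaningful for functions that avoid -oo, as +oo + -oo is not a
   meaningful sum; at t = 0 and t = 1 the convention 0 * +oo = 0 makes the
   inequality trivial.  Finite-valued functions use the library's
   [convex_function] instead. *)
Definition econvex (R : realType) (n : nat) (f : 'rV[R]_n -> \bar R) : Prop :=
  forall (x y : 'rV[R]_n) (t : R), 0 <= t <= 1 ->
    (f (t *: x + (1 - t) *: y)%R <= t%:E * f x + (1 - t)%:E * f y)%E.

Definition minimizers (R : realType) (n : nat) (g : 'rV[R]_n -> \bar R) :
  set 'rV[R]_n := [set x | forall y, (g x <= g y)%E].

Definition subdiff (R : realType) (n : nat) (f : 'rV[R]_n -> \bar R)
  (x : 'rV[R]_n) : set 'rV[R]_n :=
  [set xs | forall y, (f x + (inner xs (y - x))%:E <= f y)%E].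

Definition Hplus (R : realType) (n : nat) (x xs : 'rV[R]_n) : set 'rV[R]_n :=
  [set y | 0 <= inner xs (y - x)].

Definition Hyper (R : realType) (n : nat) (x xs : 'rV[R]_n) : set 'rV[R]_n :=
  [set y | inner xs (y - x) = 0].

(* The degenerate case xs = 0, where the set is the whole space, is allowed
   by convention. *)
Definition hyperplane (R : realType) (n : nat) (H : set 'rV[R]_n) : Prop :=
  exists x xs : 'rV[R]_n, H = Hyper x xs.

Definition upper_region (R : realType) (n : nat) (f : 'rV[R]_n -> \bar R)
  (x : 'rV[R]_n) : set 'rV[R]_n :=
  \bigcup_(xs in subdiff f x) Hplus x xs.

(* Paths are functions on R of which only the restriction to [0, 1] matters. *)
Definition ultimate_region (R : realType) (n : nat) (f : 'rV[R]_n -> \bar R)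
  (rho : R -> 'rV[R]_n) : set 'rV[R]_n :=
  \bigcap_(t in `[0, 1]) upper_region f (rho t).

Definition searching_path (R : realType) (n : nat) (f : 'rV[R]_n -> \bar R)
  (rho : R -> 'rV[R]_n) : Prop :=
  {within `[0, 1], continuous rho} /\
  (forall t : R, 0 <= t <= 1 -> edom f (rho t)).

Definition regularized_by (R : realType) (n : nat) (f : 'rV[R]_n -> \bar R)
  (psi : 'rV[R]_n -> R) (lam : R -> R) (rho : R -> 'rV[R]_n) : Prop :=
  forall t : R, 0 <= t <= 1 ->
    minimizers (fun x => f x + (lam t * psi x)%:E)%E (rho t).

(* Main.v *)
(** At each time [t] the sum rule for subdifferentials gives a subgradient [g_t]
of [f] at [rho t] with [-g_t / lam t] a subgradient of [psi] there, so that
[lam t * (psi (rho t) - psi y) <= <g_t, y - rho t>] for all [y]; (i) and (ii)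
follow at once.  For (iii), let [rho s] minimise [psi] along the path and let
[x0] minimise [f].  Reflecting [x0] through [rho s] gives a point
[z = 2 rho s - x0] with
[<g_t, z - rho t> >= 2 lam t (psi (rho t) - psi (rho s)) + (f (rho t) - f x0)],
where both summands are nonnegative.  If [f (rho t)] is not close to the
minimum, the second summand absorbs small perturbations of [z], since [f] being
bounded above near the compact path bounds [g_t]; otherwise the first one does,
since likewise [g_t / lam t] is bounded, whatever the size of [lam t].  If [f]
is minimal all along the path, [0] is always a subgradient and the ultimate
region is the whole space. *)
Require Import Defs.
From mathcomp Require Import all_boot all_order all_algebra.
From mathcomp Require Import all_classical all_reals all_analysis.
From mathcomp Require Import ring lra.

Import Order.TTheory GRing.Theory Num.Theory.
Import numFieldNormedType.Exports.

Local Open Scope classical_set_scope.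
Local Open Scope ring_scope.

(** * The coordinate inner product and its interaction with the sup norm *)

Section Inner.
Context {R : realType} {n : nat}.
Implicit Types (u v w x g : 'rV[R]_n) (a r : R).

Lemma innerDr g u v : inner g (u + v) = inner g u + inner g v.
Proof. by rewrite -big_split; apply: eq_bigr => i _; rewrite mxE mulrDr. Qed.

Lemma innerDl g g' u : inner (g + g') u = inner g u + inner g' u.
Proof. by rewrite -big_split; apply: eq_bigr => i _; rewrite mxE mulrDl. Qed.

Lemma innerZr g a u : inner g (a *: u) = a * inner g u.
Proof. by rewrite mulr_sumr; apply: eq_bigr => i _; rewrite mxE mulrCA. Qed.

Lemma innerZl g a u : inner (a *: g) u = a * inner g u.
Proof. by rewrite mulr_sumr; apply: eq_bigr => i _; rewrite mxE mulrA. Qed.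

Lemma innerNr g u : inner g (- u) = - inner g u.
Proof. by rewrite -scaleN1r innerZr mulN1r. Qed.

Lemma innerBr g u v : inner g (u - v) = inner g u - inner g v.
Proof. by rewrite innerDr innerNr. Qed.

Lemma inner0l u : inner 0 u = 0.
Proof. by apply: big1 => i _; rewrite mxE mul0r. Qed.

Lemma inner_delta (i : 'I_n) u : inner (delta_mx 0 i) u = u 0 i.
Proof.
rewrite /inner (bigD1 i)//= mxE !eqxx mul1r big1 ?addr0// => k ki.
by rewrite mxE (negPf ki) andbF mul0r.
Qed.

Lemma coord_le_norm u i : `|u 0 i| <= `|u|.
Proof.
rewrite [leRHS]mx_normrE.
exact: (le_bigmax_cond 0 (fun k : 'I_1 * 'I_n => `|u k.1 k.2|)
  (j := (ord0, i))).
Qed.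

Lemma norm_le_coord u r : 0 <= r -> (forall i, `|u 0 i| <= r) -> `|u| <= r.
Proof.
move=> r0 ur; rewrite [leLHS]mx_normrE; apply/bigmax_leP.
split=> //= -[i j] _ /=.
by rewrite (ord1 i).
Qed.

(** Hoelder's inequality: the norm on row vectors is the sup norm, hence the l1 norm of [g]. *)
Lemma norm_inner_le g u : `|inner g u| <= (\sum_(i < n) `|g 0 i|) * `|u|.
Proof.
rewrite mulr_suml; apply: (le_trans (ler_norm_sum _ _ _)).
by apply: ler_sum => i _; rewrite normrM ler_wpM2l// coord_le_norm.
Qed.

Lemma nbhs_closed_ballP x (A : set 'rV[R]_n) :
  nbhs x A <-> exists2 r, 0 < r & forall u, `|u| <= r -> A (x + u).
Proof.
split=> [/nbhs_ballP[r /= r0 rA]|[r r0 rA]].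
- exists (r / 2); first by rewrite divr_gt0.
  move=> u ur; apply: rA; rewrite -ball_normE /= opprD addNKr normrN.
  by rewrite (le_lt_trans ur)// ltr_pdivrMr// ltr_pMr// ltr1n.
- apply/nbhs_ballP; exists r => //= y; rewrite -ball_normE /= => xy.
  by rewrite -(subrK x y) addrC; apply: rA; rewrite distrC ltW.
Qed.

End Inner.

(** * A finite-dimensional Hahn-Banach theorem *)

Section HahnBanach.
Context {R : realType} {n : nat} (K : 'rV[R]_n -> R -> Prop).

Hypothesis K_convex : forall (u v : 'rV[R]_n) (a b t : R),
  K u a -> K v b -> 0 <= t <= 1 ->
  K (t *: u + (1 - t) *: v) (t * a + (1 - t) * b).
Hypothesis K_total : forall u, exists a, K u a.
Hypothesis K_ge0 : forall a, K 0 a -> 0 <= a.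

(** [K] acts as the epigraph of a convex function that is nowhere +oo and is nonnegative at 0. The
    minorant is built one coordinate at a time: vectors with negative new coordinate bound the new
    slope from below, those with positive one bound it from above, convexity orders these bounds,
    and the supremum of the lower ones serves as slope. *)
Lemma convex_relation_minorant : exists g : 'rV[R]_n, forall (u : 'rV[R]_n) a,
  K u a -> inner g u <= a.
Proof.
have H j : (j <= n)%N -> exists g : 'rV[R]_n, forall (u : 'rV[R]_n) a,
    (forall i : 'I_n, (j <= i)%N -> u 0 i = 0) -> K u a -> inner g u <= a.
  elim: j => [_|j IH jn].
    exists 0 => u a u0 Kua; rewrite inner0l; apply: K_ge0.
    suff <- : u = 0 by [].
    by apply/rowP => i; rewrite u0// mxE.
  have [g gP] := IH (ltnW jn); pose o := Ordinal jn.
  pose supp (u : 'rV[R]_n) := forall i : 'I_n, (j < i)%N -> u 0 i = 0.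
  pose S : set R := [set d | exists u a,
    [/\ supp u, K u a, u 0 o < 0 & d = (inner g u - a) / - u 0 o]].
  have ubS v b : supp v -> K v b -> 0 < v 0 o ->
      ubound S ((b - inner g v) / v 0 o).
    move=> vS Kvb v0 _ [u [a [uS Kua u0 ->]]].
    have s0 : 0 < v 0 o - u 0 o by rewrite subr_gt0 (lt_trans u0).
    (* This weight cancels coordinate [o] of [t *: u + (1 - t) *: v], which brings the combination
       within reach of the induction hypothesis. *)
    pose t := v 0 o / (v 0 o - u 0 o).
    have t01 : 0 <= t <= 1.
      apply/andP; split; first by rewrite divr_ge0// ltW.
      by rewrite ler_pdivrMr// mul1r lerDl oppr_ge0 ltW.
    have := gP _ _ _ (K_convex _ _ _ _ _ Kua Kvb t01).
    rewrite innerDr !innerZr => gt.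
    have {gt} : t * inner g u + (1 - t) * inner g v <= t * a + (1 - t) * b.
      apply: gt => i; rewrite leq_eqVlt => /predU1P[ji|ji].
        have -> : i = o by apply/val_inj.
        by rewrite !mxE /t; field; rewrite gt_eqF.
      by rewrite !mxE uS// vS// !mulr0 addr0.
    have -> : 1 - t = - u 0 o / (v 0 o - u 0 o).
      by rewrite /t; field; rewrite gt_eqF.
    rewrite /t ![_ / (v 0 o - u 0 o) * _]mulrAC -!mulrDl ler_pM2r ?invr_gt0//.
    move=> h; rewrite ler_pdivrMr ?oppr_gt0// mulrAC ler_pdivlMr//.
    lra.
  have supp_delta c : supp (c *: delta_mx 0 o).
    by move=> i ji; rewrite !mxE (_ : i == o = false) ?mulr0//; apply/eqP=> io;
      rewrite io ltnn in ji.
  have delta_o c : (c *: delta_mx 0 o : 'rV[R]_n) 0 o = c.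
    by rewrite !mxE !eqxx mulr1.
  have S0 : S !=set0.
    have [a Ka] := K_total ((- 1) *: delta_mx 0 o).
    eexists; exists ((- 1) *: delta_mx 0 o), a.
    by split; rewrite ?delta_o ?ltrN10.
  have hubS : has_ubound S.
    have [b Kb] := K_total (1 *: delta_mx 0 o).
    by eexists; apply: ubS Kb _ => //; rewrite delta_o.
  exists (g + sup S *: delta_mx 0 o) => u a uS Kua.
  rewrite innerDl innerZl inner_delta.
  have [u0|u0|u0] := ltgtP (u 0 o) 0.
  - have /(ub_le_sup hubS) : S ((inner g u - a) / - u 0 o) by exists u, a.
    by rewrite ler_pdivrMr ?oppr_gt0//; lra.
  - have := ge_sup S0 (ubS _ _ uS Kua u0).
    by rewrite ler_pdivlMr//; lra.
  - rewrite u0 mulr0 addr0; apply: gP Kua => i.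
    rewrite leq_eqVlt => /predU1P[ji|]; last exact: uS.
    by have -> : i = o by apply/val_inj.
have [g gP] := H n (leqnn n).
by exists g => u a; apply: gP => i; rewrite leqNgt ltn_ord.
Qed.

End HahnBanach.

(** Convexity of [C] is included, and [F] is unconstrained off [C], so that [fine \o f] on [edom f]
    can stand for an extended-valued [f]. *)
Definition convex_on {R : realType} {n : nat} (C : set 'rV[R]_n)
    (F : 'rV[R]_n -> R) : Prop :=
  forall x y t, C x -> C y -> 0 <= t <= 1 ->
    C (t *: x + (1 - t) *: y) /\
    F (t *: x + (1 - t) *: y) <= t * F x + (1 - t) * F y.

(** * Real-valued convex functions: sum rule, local bounds, continuity *)

Section ConvexOn.
Context {R : realType} {n : nat}.
Implicit Types (x y z u v w g : 'rV[R]_n) (a r M : R).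
Implicit Types (C : set 'rV[R]_n) (F psi : 'rV[R]_n -> R).

Lemma convex_on_setT psi : convex_function setT psi -> convex_on setT psi.
Proof.
move=> H x y t _ _ /andP[t0 t1]; split=> //.
by have := H (Itv01 t0 t1) x y; rewrite !inE; apply.
Qed.

Lemma convex_on_scale C F a : 0 <= a ->
  convex_on C F -> convex_on C (fun x => a * F x).
Proof.
move=> a0 H x y t Cx Cy t01; have [Ct Ft] := H x y t Cx Cy t01; split=> //.
by rewrite !(mulrCA _ a) -mulrDr ler_wpM2l.
Qed.

Lemma econvex_fine (f : 'rV[R]_n -> \bar R) : proper_fun f -> econvex f ->
  convex_on (edom f) (fine \o f).
Proof.
move=> [fNy _] fc x y t xd yd t01; have /andP[t0 t1] := t01.
have fin z : edom f z -> f z \is a fin_num.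
  by move=> zd; rewrite fin_numE fNy lt_eqF.
have := fc x y t t01; rewrite -[f x]fineK ?fin// -[f y]fineK ?fin//.
rewrite -!EFinM -EFinD.
move=> fxy; have zd : edom f (t *: x + (1 - t) *: y).
  by apply: le_lt_trans fxy _; rewrite ltry.
by split=> //=; move: fxy; rewrite -[f (_ + _)]fineK ?fin//.
Qed.

(* [K] is the epigraph of the infimal convolution of [F] with [psi] reflected,
   shifted so as to be nonnegative at [0]. *)
Lemma subgradient_sum C F psi x :
    convex_on C F -> convex_on setT psi -> C x ->
    (forall y, C y -> F x + psi x <= F y + psi y) ->
  exists g, (forall y, C y -> F x + inner g (y - x) <= F y) /\
            (forall y, psi x - inner g (y - x) <= psi y).
Proof.
move=> Fc psic Cx xmin; pose m := F x + psi x.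
pose K (u : 'rV[R]_n) a := exists2 w, C w & F w + psi (w - u) - m <= a.
have [|u|a [w Cw]|g gP] := @convex_relation_minorant R n K.
- move=> u v a b t [w Cw wa] [z Cz zb] t01; have /andP[t0 t1] := t01.
  have [Cwz Fwz] := Fc w z t Cw Cz t01.
  have [_ psiwz] := psic (w - u) (z - v) t I I t01.
  exists (t *: w + (1 - t) *: z) => //.
  rewrite opprD addrACA -!scalerBr.
  have := lerD (ler_wpM2l t0 wa) (ler_wpM2l (_ : 0 <= 1 - t) zb).
  rewrite subr_ge0 => /(_ t1); lra.
- by eexists; exists x.
- by rewrite subr0; apply: le_trans; rewrite subr_ge0 xmin.
exists g; split=> y; last first.
  (* The witness [w = x] isolates [psi]; the witness [w = y], used next, isolates [F]. *)
  have /gP : K (x - y) (F x + psi y - m) by exists x => //; rewrite subKr.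
  by rewrite -(opprB y x) innerNr /m; lra.
move=> Cy; have /gP : K (y - x) (F y + psi x - m).
  by exists y => //; rewrite subKr.
by rewrite /m; lra.
Qed.

(* Induction on the number of nonzero coordinates of [u]: [x + u] is the midpoint
   of a point with one coordinate fewer and a point of a segment along an axis. *)
Lemma convex_locally_bounded C F x : convex_on C F -> nbhs x C ->
  exists r M, 0 < r /\ forall u, `|u| <= r -> C (x + u) /\ F (x + u) <= M.
Proof.
move=> Fc /nbhs_closed_ballP[r r0 rC].
have H j : (j <= n)%N -> exists s M, 0 < s /\ forall u : 'rV[R]_n,
    (forall i : 'I_n, (j <= i)%N -> u 0 i = 0) -> `|u| <= s ->
    C (x + u) /\ F (x + u) <= M.
  elim: j => [_|j IH jn].
    exists r, (F x); split=> // u u0 ur; split; first exact: rC.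
    suff -> : u = 0 by rewrite addr0.
    by apply/rowP => i; rewrite u0// mxE.
  have [s [M [s0 sM]]] := IH (ltnW jn); pose o := Ordinal jn.
  pose N := Num.max (F (x + r *: delta_mx 0 o)) (F (x - r *: delta_mx 0 o)).
  have norm_delta : `|delta_mx 0 o : 'rV[R]_n| <= 1.
    apply: norm_le_coord => // i; rewrite mxE.
    by case: (_ && _); rewrite ?normr1 ?normr0.
  have line c : `|c| <= r ->
      C (x + c *: delta_mx 0 o) /\ F (x + c *: delta_mx 0 o) <= N.
    move=> cr; have := cr; rewrite ler_norml => /andP[c1 c2].
    pose t := (r + c) / (2 * r).
    have r20 : 0 < 2 * r by rewrite mulr_gt0.
    have t01 : 0 <= t <= 1.
      rewrite divr_ge0 ?(ltW r20)//=; last by lra.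
      by rewrite ler_pdivrMr//; lra.
    have Cr e : `|e| <= r -> C (x + e *: delta_mx 0 o).
      move=> er; apply: rC; rewrite normrZ.
      by apply: le_trans er; rewrite ler_piMr.
    have rr : `|r| <= r by rewrite ger0_norm// ltW.
    have Cp : C (x + r *: delta_mx 0 o) by exact: Cr.
    have Cm : C (x - r *: delta_mx 0 o).
      by rewrite -scaleNr; apply: Cr; rewrite normrN.
    have [_] := Fc _ _ t Cp Cm t01.
    have -> : t *: (x + r *: delta_mx 0 o) + (1 - t) *: (x - r *: delta_mx 0 o)
        = x + c *: delta_mx 0 o.
      apply/rowP => i; rewrite !mxE /t; field.
      by rewrite gt_eqF.
    move=> Fle; split; first exact: Cr.
    apply: le_trans Fle _; have /andP[t0 t1] := t01.
    have h1 : F (x + r *: delta_mx 0 o) <= N by rewrite le_max lexx.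
    have h2 : F (x - r *: delta_mx 0 o) <= N by rewrite le_max lexx orbT.
    have := lerD (ler_wpM2l t0 h1) (ler_wpM2l (_ : 0 <= 1 - t) h2).
    by rewrite subr_ge0 => /(_ t1); lra.
  (* [x + u] is the midpoint of [x + v] and [x + (2 * u 0 o) *: delta_mx 0 o]. Since [v] has norm at
     most 4 times that of [u], [s / 4] suits the first endpoint and [r / 2] the second; the bound
     averages [M] and [N]. *)
  exists (Num.min (s / 4) (r / 2)), (2^-1 * M + (1 - 2^-1) * N); split.
    by rewrite lt_min !divr_gt0.
  move=> u uS; rewrite le_min => /andP[us ur].
  have uo := coord_le_norm u o.
  pose v := 2 *: (u - u 0 o *: delta_mx 0 o).
  have [||Cv Fv] := sM v.
  - move=> i; rewrite !mxE leq_eqVlt => /predU1P[ji|ji].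
      have -> : i = o by apply/val_inj.
      by rewrite !eqxx mulr1 subrr mulr0.
    rewrite (uS i ji) (_ : i == o = false) ?andbF ?mulr0 ?subrr ?mulr0//.
    by apply/eqP => io; rewrite io ltnn in ji.
  - rewrite normrZ ger0_norm//.
    have := ler_normB u (u 0 o *: delta_mx 0 o).
    have : `|u 0 o *: delta_mx 0 o : 'rV[R]_n| <= `|u 0 o|.
      by rewrite normrZ ler_piMr.
    by lra.
  have [|Cl Fl] := line (2 * u 0 o).
    by rewrite normrM ger0_norm//; lra.
  have h01 : 0 <= (2^-1 : R) <= 1 by lra.
  have [] := Fc _ _ _ Cv Cl h01.
  have -> : 2^-1 *: (x + v) + (1 - 2^-1) *: (x + (2 * u 0 o) *: delta_mx 0 o)
      = x + u.
    by apply/rowP => i; rewrite !mxE; field.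
  by move=> Cu Fu; split=> //; apply: le_trans Fu _; lra.
have [s [M [s0 sM]]] := H n (leqnn n); exists s, M; split=> // u.
by apply: sM => i; rewrite leqNgt ltn_ord.
Qed.

(** Compactness makes the local bounds uniform. In [P], one parameter tending to +oo is both the
    bound and the inverse of the radius. *)
Lemma convex_compact_bounded C F (A : set 'rV[R]_n) :
    convex_on C F -> compact A -> A `<=` C° ->
  exists r M, 0 < r /\ forall x u, A x -> `|u| <= r ->
    C (x + u) /\ F (x + u) <= M.
Proof.
move=> Fc /compact_near_coveringP cA AC.
pose P (M : R) (x : 'rV[R]_n) := forall u : 'rV[R]_n, M * `|u| <= 1 ->
  C (x + u) /\ F (x + u) <= M.
have [x Ax|B [_ BP]] := cA R +oo P _.
  have [r [M [r0 rM]]] := convex_locally_bounded _ _ _ Fc (AC x Ax).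
  have r20 : 0 < r / 2 by rewrite divr_gt0.
  (* Half of [r] is spent on moving the centre from [x] to [y], the other half on [u], as
     [N >= 2 / r]. *)
  exists (ball x (r / 2), [set N | Num.max M (2 / r) <= N]).
    split; first exact: nbhsx_ballx.
    by apply: nbhs_pinfty_ge; rewrite num_real.
  move=> [y N] [/= xy]; rewrite ge_max => /andP[MN rN] u uN.
  have xyr : `|y - x| < r / 2 by move: xy; rewrite -ball_normE /= distrC.
  have ur : `|u| <= r / 2.
    have : (2 / r) * `|u| <= 1 by apply: le_trans uN; rewrite ler_wpM2r.
    by rewrite mulrAC ler_pdivrMr// mul1r; lra.
  have [|Cu Fu] := rM (y - x + u).
    by have := ler_normD (y - x) u; lra.
  by rewrite addrA subrKC in Cu Fu; split=> //; apply: le_trans MN.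
pose M := Num.max B 0 + 1.
have M0 : 0 < M by rewrite ltr_wpDl// le_max lexx orbT.
have BM : B < M by rewrite ltr_pwDr// le_max lexx.
exists M^-1, M; split; first by rewrite invr_gt0.
move=> x u Ax ur; apply: (BP M BM x Ax).
by rewrite -ler_pdivlMl// mulr1.
Qed.

(** A local upper bound suffices: for small [u], convexity on the line through [x] and [x + u]
    bounds [psi (x + u)] from above by means of [x + e^-1 *: u], and from below by means of
    [x - e^-1 *: u]. *)
Lemma convex_continuous psi : convex_on setT psi -> continuous psi.
Proof.
move=> psic x; have [r [M [r0 rM]]] :=
  convex_locally_bounded _ _ _ psic (@filterT _ (nbhs x) _).
have D0 : 0 <= M - psi x.
  rewrite subr_ge0 -{1}[x]addr0.
  by have [|] := rM 0; first by rewrite normr0 ltW.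
have key e u : 0 < e -> e <= 1 -> `|u| <= e * r ->
    `|psi x - psi (x + u)| <= e * (M - psi x).
  move=> e0 e1 ue.
  have ur : `|e^-1 *: u| <= r.
    by rewrite normrZ gtr0_norm ?invr_gt0// ler_pdivrMl.
  have [_ Mp] := rM _ ur.
  have [|_ Mm] := rM (- (e^-1 *: u)); first by rewrite normrN.
  have e01 : 0 <= e <= 1 by rewrite ltW.
  have [_ up] := psic (x + e^-1 *: u) x e I I e01.
  (* With this weight, [x] is a convex combination of [x - e^-1 *: u] and [x + u]. *)
  have t01 : 0 <= e / (1 + e) <= 1.
    rewrite divr_ge0 ?(ltW e0)//=; last by lra.
    by rewrite ler_pdivrMr; lra.
  have [_ lo] := psic (x - e^-1 *: u) (x + u) _ I I t01.
  have eqx : e *: (x + e^-1 *: u) + (1 - e) *: x = x + u.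
    by apply/rowP => i; rewrite !mxE; field; rewrite gt_eqF.
  have eqlo :
      (e / (1 + e)) *: (x - e^-1 *: u) + (1 - e / (1 + e)) *: (x + u) = x.
    by apply/rowP => i; rewrite !mxE; field; rewrite !gt_eqF//; lra.
  rewrite eqx in up; rewrite eqlo in lo.
  have {}lo : (1 + e) * psi x <= e * psi (x - e^-1 *: u) + psi (x + u).
    have e10 : 0 < 1 + e by lra.
    have -> : e * psi (x - e^-1 *: u) + psi (x + u) = (1 + e) *
        (e / (1 + e) * psi (x - e^-1 *: u) + (1 - e / (1 + e)) * psi (x + u)).
      by field; rewrite gt_eqF.
    by rewrite ler_pM2l.
  have := ler_wpM2l (ltW e0) Mp; have := ler_wpM2l (ltW e0) Mm.
  by rewrite ler_norml; lra.
apply/(@cvgrPdist_le _ _ _ (nbhs x) (nbhs_filter x)) => e e0.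
pose d := Num.min 1 (e / (M - psi x + 1)).
have d0 : 0 < d by rewrite lt_min ltr01 divr_gt0// ltr_wpDl.
apply/(nbhs_closed_ballP _ [set y | `|psi x - psi y| <= e]).
exists (d * r); first by rewrite mulr_gt0.
move=> u ud; apply: le_trans (key d u d0 _ ud) _; first by rewrite ge_min lexx.
have : d <= e / (M - psi x + 1) by rewrite ge_min lexx orbT.
by rewrite ler_pdivlMr ?ltr_wpDl//; lra.
Qed.

End ConvexOn.

(** * Extended-valued convex functions and the optimality condition *)

Section ExtendedConvex.
Context {R : realType} {n : nat}.
Variable f : 'rV[R]_n -> \bar R.
Hypotheses (f_proper : proper_fun f) (f_convex : econvex f).

Lemma edom_fineK x : edom f x -> (fine (f x))%:E = f x.
Proof. by move=> xd; rewrite fineK// fin_numE f_proper.1 lt_eqF. Qed.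

Lemma edom_open : (forall x, boundary (edom f) x -> f x = +oo%E) ->
  edom f `<=` (edom f)°.
Proof.
move=> f_bd x xd; apply: contrapT => xi.
have := f_bd x (conj (subset_closure xd) xi).
by move: xd; rewrite /edom /= => /lt_eqF/eqP.
Qed.

(** Fermat's rule with the sum rule: the second conclusion says that [- g] is a subgradient of
    [l * psi] at [x]. *)
Lemma minimizer_sum_subdiff (psi : 'rV[R]_n -> R) (l : R) x :
    convex_on setT psi -> 0 <= l -> edom f x ->
    minimizers (fun y => f y + (l * psi y)%:E)%E x ->
  exists2 g, subdiff f x g & forall y, l * (psi x - psi y) <= inner g (y - x).
Proof.
move=> psic l0 xd xmin.
have [|g [gf gpsi]] := subgradient_sum _ _ _ x
  (econvex_fine _ f_proper f_convex) (convex_on_scale _ _ _ l0 psic) xd.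
  move=> y yd; have := xmin y.
  by rewrite -(edom_fineK x)// -(edom_fineK y)// -!EFinD lee_fin.
exists g => y; last by have := gpsi y; lra.
rewrite -(edom_fineK x)//.
have [yd|yd] := pselect (edom f y).
  by rewrite -(edom_fineK y)// -EFinD lee_fin gf.
by move: yd; rewrite /edom /= ltey => /negP/negPn/eqP ->; rewrite leey.
Qed.

End ExtendedConvex.

(** * Small perturbations, and the geometry of the regularization path *)

Lemma exists_small {R : realType} (a b : R) : 0 < b ->
  exists2 e, 0 < e & e * a <= b.
Proof.
move=> b0; exists (b / (`|a| + 1)); first by rewrite divr_gt0// ltr_wpDl.
rewrite mulrAC ler_pdivrMr ?ltr_wpDl// ler_pM2l//.
by apply: le_trans (ler_norm a) _; rewrite lerDl.
Qed.

Lemma nbhs_inner_gt0 {R : realType} {n : nat} (g x y : 'rV[R]_n) :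
  0 < inner g (y - x) -> nbhs y (Hplus x g).
Proof.
move=> gy; have [e e0 eg] := exists_small (\sum_(i < n) `|g 0 i|) _ gy.
apply/nbhs_closed_ballP; exists e => // u ue; rewrite /Hplus /= addrAC innerDr.
have := norm_inner_le g u; rewrite ler_norml => /andP[+ _].
have : (\sum_(i < n) `|g 0 i|) * `|u| <= (\sum_(i < n) `|g 0 i|) * e.
  by rewrite ler_wpM2l// sumr_ge0.
by lra.
Qed.

Theorem theorem3p1 (R : realType) (n : nat)
  (f : 'rV[R]_n -> \bar R) (psi : 'rV[R]_n -> R) (lam : R -> R)
  (rho : R -> 'rV[R]_n)
  (f_proper : proper_fun f)
  (f_convex : econvex f)
  (f_min : minimizers f !=set0)
  (f_bd : forall x, boundary (edom f) x -> f x = +oo%E)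
  (psi_convex : convex_function setT psi)
  (lam_gt0 : forall t : R, 0 <= t -> 0 < lam t)
  (rho_path : searching_path f rho)
  (rho_reg : regularized_by f psi lam rho) :
  (forall t1 t2 : R, 0 <= t1 <= 1 -> 0 <= t2 <= 1 ->
     f (rho t1) = f (rho t2) ->
     psi (rho t1) = psi (rho t2) /\
     exists H : set 'rV[R]_n, hyperplane H /\
       forall t : R, 0 <= t <= 1 -> f (rho t) = f (rho t1) ->
         exists2 g, subdiff f (rho t) g & Hyper (rho t) g = H) /\
  (forall t1 t2 : R, 0 <= t1 <= 1 -> 0 <= t2 <= 1 ->
     (f (rho t2) < f (rho t1))%E ->
     psi (rho t1) < psi (rho t2) /\
     (upper_region f (rho t2))° (rho t1)) /\
  (ultimate_region f rho)° !=set0.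
Proof.
have [rho_cont rho_dom] := rho_path.
have psic := convex_on_setT _ psi_convex.
have lamP t : 0 <= t <= 1 -> 0 < lam t by move=> /andP[t0 _]; exact: lam_gt0.
pose F x := fine (f x).
have FE x : edom f x -> f x = (F x)%:E by move=> xd; rewrite edom_fineK.
have Frho t : 0 <= t <= 1 -> f (rho t) = (F (rho t))%:E.
  by move=> t01; apply: FE; exact: rho_dom.
have reg s t : 0 <= s <= 1 -> 0 <= t <= 1 ->
    F (rho s) + lam s * psi (rho s) <= F (rho t) + lam s * psi (rho t).
  move=> s01 t01; have := rho_reg s s01 (rho t).
  by rewrite /= !Frho// -!EFinD lee_fin.
have subg t : 0 <= t <= 1 -> exists2 g, subdiff f (rho t) g &
    forall y, lam t * (psi (rho t) - psi y) <= inner g (y - rho t).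
  move=> t01; apply: minimizer_sum_subdiff => //; first exact/ltW/lamP.
  - exact: rho_dom.
  - exact: rho_reg.
have psi_eq s t : 0 <= s <= 1 -> 0 <= t <= 1 ->
    f (rho s) = f (rho t) -> psi (rho s) = psi (rho t).
  move=> s01 t01 fst; have Fst : F (rho s) = F (rho t) by rewrite /F fst.
  apply/eqP; rewrite eq_le.
  have := reg s t s01 t01; have := reg t s t01 s01.
  by rewrite Fst !lerD2l !ler_pM2l ?lamP// => -> ->.
have psi_lt s t : 0 <= s <= 1 -> 0 <= t <= 1 ->
    F (rho t) < F (rho s) -> psi (rho s) < psi (rho t).
  move=> s01 t01 Fts; have := reg s t s01 t01 => h.
  by rewrite -(ltr_pM2l (lamP s s01)); lra.
split; [|split].
- move=> t1 t2 t101 t201 f12; split; first exact: psi_eq.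
  have [g gf gpsi] := subg t1 t101.
  exists (Hyper (rho t1) g); split; first by exists (rho t1), g.
  move=> t t01 ft.
  (* The subgradient inequality of [f] gives one sign and that of [psi] the other. Hence [g], chosen
     at [t1], is also a subgradient at [rho t] and defines the same hyperplane there. *)
  have g0 : inner g (rho t - rho t1) = 0.
    apply/eqP; rewrite eq_le; apply/andP; split.
      have := gf (rho t); rewrite ft Frho// -EFinD lee_fin; lra.
    by have := gpsi (rho t); rewrite (psi_eq t t1)// subrr mulr0.
  have gE y : inner g (y - rho t) = inner g (y - rho t1).
    by move: g0; rewrite !innerBr; lra.
  exists g; first by move=> y; rewrite ft gE; exact: gf.
  by apply/seteqP; split=> y; rewrite /Hyper /= gE.
- move=> t1 t2 t101 t201 f21.
  have psi12 : psi (rho t1) < psi (rho t2).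
    by apply: psi_lt => //; rewrite -lte_fin -!Frho.
  split=> //; have [g gf gpsi] := subg t2 t201.
  (* A single halfspace suffices: the inner product at [rho t1] is at least
     [lam t2 * (psi (rho t2) - psi (rho t1))], which is positive. *)
  apply: filterS (nbhs_inner_gt0 g (rho t2) (rho t1) _) => [y Hy|].
    by exists g.
  by apply: lt_le_trans (gpsi _); rewrite mulr_gt0 ?lamP// subr_gt0.
have [x0 x0min] := f_min.
have x0d : edom f x0.
  by apply: le_lt_trans (x0min (rho 0)) _; apply: rho_dom; rewrite lexx ler01.
pose m := F x0.
have mF x : edom f x -> m <= F x.
  by move=> xd; rewrite -lee_fin -!FE.
have [s s01 smin] : exists2 s, 0 <= s <= 1 &
    forall t, 0 <= t <= 1 -> psi (rho s) <= psi (rho t).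
  have [|s] := @EVT_min R (psi \o rho) 0 1 ler01.
    move=> t; apply: continuous_comp (rho_cont t) _ => //.
    exact: convex_continuous.
  rewrite in_itv /= => s01 smin; exists s => // t t01; exact: smin.
(* The least penalty along the path goes with the largest value of [f]. *)
have smax t : 0 <= t <= 1 -> F (rho t) <= F (rho s).
  move=> t01; rewrite leNgt; apply/negP => /psi_lt.
  by move=> /(_ t01 s01); rewrite ltNge smin.
have [Fm|mFs] := leP (F (rho s)) m.
  exists 0; apply: filterS filterT => y _ t /=; rewrite in_itv /= => t01.
  exists 0; last by rewrite /Hplus /= inner0l.
  move=> z; rewrite inner0l adde0; apply: le_trans (x0min z).
  by rewrite Frho// FE// lee_fin (le_trans (smax _ t01)).
(* Half of the gap: each [F (rho t)] is at least [eta] above [m] or more than [eta] below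
   [F (rho s)]. *)
pose eta := (F (rho s) - m) / 2.
have eta0 : 0 < eta by rewrite divr_gt0// subr_gt0.
have Kc : compact (rho @` `[0, 1]).
  by apply: continuous_compact => //; exact: segment_compact.
have [|r1 [M1 [r10 bnd1]]] := convex_compact_bounded _ _ _
  (econvex_fine _ f_proper f_convex) Kc.
  move=> _ [t /= + <-]; rewrite in_itv /= => t01.
  by apply: edom_open => //; exact: rho_dom.
have [|r2 [M2 [r20 bnd2]]] := convex_compact_bounded _ _ _ psic Kc.
  by rewrite interiorT.
(* Rescaling [w] by [e1^-1] or [e2^-1] allows test points at distance up to [r1] or [r2]; the
   factors [e1] and [e2] then make the loss in [inner g w] at most [eta] or
   [lam t * (eta / lam s)]. *)
have [e1 e10 e1P] := exists_small (M1 - m) _ eta0.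
have [|e2 e20 e2P] := exists_small (M2 - psi (rho s)) (eta / lam s).
  by rewrite divr_gt0 ?lamP.
exists (rho s + (rho s - x0)); apply/nbhs_closed_ballP.
exists (Num.min (e1 * r1) (e2 * r2)); first by rewrite lt_min !mulr_gt0.
move=> w; rewrite le_min => /andP[w1 w2] t /=; rewrite in_itv /= => t01.
have [g gf gpsi] := subg t t01; exists g => //.
have Kt : (rho @` `[0, 1]) (rho t) by exists t => //=; rewrite in_itv.
have lt0 := lamP t t01; have ls0 := lamP s s01.
have Ft := mF _ (rho_dom t t01).
rewrite /Hplus /=.
have -> : inner g (rho s + (rho s - x0) + w - rho t) =
    2 * inner g (rho s - rho t) - inner g (x0 - rho t) + inner g w.
  by rewrite !(innerDr, innerNr); ring.
have A0 := gpsi (rho s).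
have B0 : F (rho t) + inner g (x0 - rho t) <= m.
  by rewrite -lee_fin EFinD -Frho// -FE//; exact: gf.
have pst := smin t t01.
have A1 : 0 <= lam t * (psi (rho t) - psi (rho s)).
  by apply: mulr_ge0; [exact: ltW|rewrite subr_ge0].
have [Fbig|Fsmall] := leP eta (F (rho t) - m).
(* The subgradient inequality of [f] at [rho t - e1^-1 *: w] yields [- inner g w <= eta], which
   [F (rho t) - m] compensates. *)
- have [|Cu Fu] := bnd1 (rho t) (- (e1^-1 *: w)) Kt.
    by rewrite normrN normrZ gtr0_norm ?invr_gt0// ler_pdivrMl.
  have : F (rho t) - e1^-1 * inner g w <= M1.
    apply: le_trans Fu; rewrite -lee_fin -FE// EFinB -Frho//.
    have := gf (rho t - e1^-1 *: w).
    by rewrite addrAC subrr add0r innerNr innerZr.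
  move=> h; have : e1^-1 * - inner g w <= M1 - m by lra.
  by rewrite ler_pdivrMl//; lra.
- have [|_ pu] := bnd2 (rho t) (e2^-1 *: w) Kt.
    by rewrite normrZ gtr0_norm ?invr_gt0// ler_pdivrMl.
  have := gpsi (rho t + e2^-1 *: w); rewrite addrAC subrr add0r innerZr.
  rewrite ler_pdivlMl// => gw.
  (* Optimality of [rho s] at time [s] turns the drop of [f] into a rise of [psi] measured by
     [lam s] alone; [lam t] then scales both the gain and the loss. *)
  have gap : eta / lam s <= psi (rho t) - psi (rho s).
    have := reg s t s01 t01; rewrite ler_pdivrMr//.
    by move: Fsmall; rewrite /eta; lra.
  have : lam t * (e2 * (M2 - psi (rho s))) <=
      lam t * (psi (rho t) - psi (rho s)).
    by rewrite ler_pM2l// (le_trans e2P).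
  have : e2 * (lam t * (psi (rho s) - M2)) <=
      e2 * (lam t * (psi (rho t) - psi (rho t + e2^-1 *: w))).
    by rewrite !ler_pM2l//; lra.
  lra.
Qed.
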